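(* Suppose $P$ is a probability distribution on $\mathbb{R}^d$ with positive volume dimension $d_{\mathrm{vol}}=d_{\mathrm{vol}}(P)>0$ (relative to the fixed set $\mathbb{X}\subset\mathbb{R}^d$) satisfying $$\sup_{x\in\mathbb{X}}\liminf_{r\to0}\frac{P(\mathbb{B}_{\mathbb{R}^d}(x,r))}{r^{d_{\mathrm{vol}}}}>0.$$ Let $K:\mathbb{R}^d\to\mathbb{R}$ be a kernel function with $\|K\|_\infty<\infty$, $\int_0^\infty t^{d_{\mathrm{vol}}-1}\sup_{\|x\|\ge t}|K(x)|\,dt<\infty$, and $\lim_{t\to0}\inf_{\|x\|\le t}K(x)>0$. Suppose $\lim_n n h_n^{d_{\mathrm{vol}}}=\infty$. Then, with probability $1-\delta$, the following holds for all large enough $n$ and small enough $h_n$: $$\sup_{x\in\mathbb{X}}|\hat p_{h_n}(x)-p_{h_n}(x)|\ge C_{P,K,\delta}\sqrt{\frac{1}{n h_n^{2d-d_{\mathrm{vol}}}}},$$ where $C_{P,K,\delta}$ is a (positive) constant depending only on $P$, $K$ and $\delta$.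
   Context: A subset $\mathbb{X}\subset\mathbb{R}^d$ is fixed, $(h_n)$ is a sequence of positive bandwidths, and $\delta\in(0,1)$. $\|\cdot\|$ is the Euclidean norm, $\|K\|_\infty$ is the sup norm, and $\mathbb{B}_{\mathbb{R}^d}(x,r)=\{y\in\mathbb{R}^d:\|y-x\|<r\}$. The volume dimension of $P$ is $$d_{\mathrm{vol}}(P)=\sup\left\{\nu\ge0:\ \limsup_{r\to0}\sup_{x\in\mathbb{X}}\frac{P(\mathbb{B}_{\mathbb{R}^d}(x,r))}{r^\nu}<\infty\right\}.$$ Kernel density estimator based on $X_1,\dots,X_n$ i.i.d. from $P$: $\hat p_h(x)=\frac{1}{nh^d}\sum_{i=1}^nK\left(\frac{x-X_i}{h}\right)$, and $p_h(x)=\mathbb{E}[\hat p_h(x)]$. *)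

(* Defs.v *)
From HB Require Import structures.
From mathcomp Require Import all_boot all_order all_algebra finmap.
From mathcomp Require Import all_classical all_reals all_analysis.

Set Implicit Arguments.
Unset Strict Implicit.
Unset Printing Implicit Defensive.
Import Order.TTheory GRing.Theory Num.Theory.
Import numFieldNormedType.Exports.
Local Open Scope classical_set_scope.
Local Open Scope ring_scope.

(* R^d with its Borel sigma-algebra. The library norm `|x| on row vectors is
   the max norm: it induces the Euclidean topology, hence the right Borel sets,
   but the Euclidean norm has to be defined separately. *)
Definition euclidean (R : realType) (d : nat) : Type := 'rV[R]_d.

HB.instance Definition _ (R : realType) (d : nat) :=
  GRing.Lmodule.copy (euclidean R d) 'rV[R]_d.
HB.instance Definition _ (R : realType) (d : nat) :=
  Measurable.copy (euclidean R d) (g_sigma_algebraType (@open 'rV[R]_d)).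

Section euclidean_space.
Context {R : realType} {d : nat}.
Implicit Types (x : euclidean R d) (r t : R).

Definition enorm x : R := Num.sqrt (\sum_(j < d) (x : 'rV[R]_d) ord0 j ^+ 2).

Definition eball x r : set (euclidean R d) := [set y | enorm (y - x) < r].

Definition sup_norm (K : euclidean R d -> R) : \bar R :=
  ereal_sup [set `|K x|%:E | x in setT].

Definition sup_outside (K : euclidean R d -> R) t : \bar R :=
  ereal_sup [set `|K x|%:E | x in [set x | t <= enorm x]].

Definition inf_inside (K : euclidean R d -> R) t : \bar R :=
  ereal_inf [set (K x)%:E | x in [set x | enorm x <= t]].

(* The dimension is an extended real: it is +oo when the small-ball
   probabilities decay faster than every power of the radius. *)
Definition volume_dimension (XX : set (euclidean R d))
    (P : probability (euclidean R d) R) : \bar R :=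
  ereal_sup [set nu%:E | nu in [set nu : R | 0 <= nu /\
    (limf_esup (fun r : R =>
       ereal_sup [set P (eball x r) / (r `^ nu)%:E | x in XX]) 0^'+
     < +oo)%E]].

End euclidean_space.

Section sampling.
Context {R : realType} {d : nat} {dO : measure_display}
  {Omega : measurableType dO}.

Definition mutually_independent (Pr : probability Omega R)
    (X : nat -> {RV Pr >-> euclidean R d}) : Prop :=
  forall (J : {fset nat}) (A : nat -> set (euclidean R d)),
    (forall i, measurable (A i)) ->
    Pr (\bigcap_(i in [set` J]) X i @^-1` A i) =
    (\prod_(i <- J) Pr (X i @^-1` A i))%E.

Definition iid (Pr : probability Omega R)
    (X : nat -> {RV Pr >-> euclidean R d})
    (P : probability (euclidean R d) R) : Prop :=
  mutually_independent X /\
  forall i (A : set (euclidean R d)), measurable A ->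
    distribution Pr (X i) A = P A.

(* The n observations X_1, ..., X_n are X 0, ..., X n.-1. *)
Definition kde (K : euclidean R d -> R) (Pr : probability Omega R)
    (X : nat -> {RV Pr >-> euclidean R d}) (n : nat) (h : R)
    (x : euclidean R d) (w : Omega) : R :=
  (n%:R * h ^+ d)^-1 * \sum_(i < n) K (h^-1 *: (x - X i w)).

Definition mean_kde (K : euclidean R d -> R) (Pr : probability Omega R)
    (X : nat -> {RV Pr >-> euclidean R d}) (n : nat) (h : R)
    (x : euclidean R d) : \bar R :=
  'E_Pr[kde K X n h x].

Definition kde_deviation (K : euclidean R d -> R) (Pr : probability Omega R)
    (X : nat -> {RV Pr >-> euclidean R d}) (n : nat) (h : R)
    (XX : set (euclidean R d)) (w : Omega) : \bar R :=
  ereal_sup [set `|(kde K X n h x w)%:E - mean_kde K X n h x|%E | x in XX].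

(* An event contained in [set w | Q w] carries the probability, because a
   supremum over an arbitrary, possibly uncountable, set of points need not be
   measurable; for measurable Q this is just p <= Pr [set w | Q w]. *)
Definition with_probability_ge (Pr : probability Omega R) (p : R)
    (Q : Omega -> Prop) : Prop :=
  exists2 A : set Omega, measurable A /\ (p%:E <= Pr A)%E &
    forall w, A w -> Q w.

End sampling.

(* Main.v *)
(* At a point [x] of [XX] where [P (eball x r) >= c r ^ dvol] for small [r], the
   summands [Z_i = K ((x - X_i) / h) - E] are bounded and centered with variance
   [s2] at least of order [h ^ dvol], so it suffices that a sum [S_n] of such
   variables is smaller than a little constant times [sqrt (n s2)] with little
   probability. This anticoncentration needs no central limit theorem: the
   functions [T / (T + u ^ 2)] are, up to a factor decaying with [T], strict
   supersolutions of the heat equation, i.e. averaging one over a step [Z] gives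
   at most [1 - s / (8 (T + s))] times the same function with [T] increased by
   [s = 4 s2]. Iterating, the 8th power of the mean of [T / (T + S_n ^ 2)] is
   at most of order [T / (T + n s)], and that mean controls
   [Pr (|S_n| < sqrt T) / 2]. *)
Require Import Defs.
From HB Require Import structures.
From mathcomp Require Import all_boot all_order all_algebra finmap.
From mathcomp Require Import all_classical all_reals all_analysis.
From mathcomp Require Import measurable_realfun ring lra.

Set Implicit Arguments.
Unset Strict Implicit.
Unset Printing Implicit Defensive.
Import Order.TTheory GRing.Theory Num.Theory.
Import numFieldNormedType.Exports.
Local Open Scope classical_set_scope.
Local Open Scope ring_scope.

(** * Algebra of the Cauchy kernel [T / (T + x ^+ 2)] *)

(** With [D] and [W] the denominators before and after the step, the first-order expansion of [W^-1]
    has exact remainder [z ^+ 2 * (2 * x + z) ^+ 2 / (D ^+ 2 * W)]; the slack [D / 10] pays for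
    replacing [W] by [D] and [2 * x + z] by [2 * x]. The bound is quadratic in [z], so its mean only
    involves the first two moments. *)
Lemma cauchy_kernel_taylor (R : realFieldType) (T M x z : R) :
  0 < T -> 100 * (100 * M ^+ 2) <= T -> `|z| <= M ->
  T / (T + (x + z) ^+ 2) <=
  T * ((T + x ^+ 2)^-1 - (2 * x * z + z ^+ 2) / (T + x ^+ 2) ^+ 2
       + (4 * x ^+ 2 + (T + x ^+ 2) / 10) * z ^+ 2 / (T + x ^+ 2) ^+ 3).
Proof.
move=> T0 MT zM; rewrite ler_pM2l//.
have zT : 100 * (100 * z ^+ 2) <= T.
  apply: le_trans MT; rewrite !ler_pM2l ?ltr0n// -[z ^+ 2]real_normK ?num_real//.
  by rewrite lerXn2r ?nnegrE// (le_trans _ zM).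
set D := T + x ^+ 2; set W := T + (x + z) ^+ 2.
have x2 : 0 <= x ^+ 2 := sqr_ge0 x.
have z2 : 0 <= z ^+ 2 := sqr_ge0 z.
have D0 : 0 < D by rewrite /D ltr_wpDr.
have W0 : 0 < W by rewrite /W ltr_wpDr// sqr_ge0.
set q := 4 * x ^+ 2 + D / 10.
have q0 : 0 <= q by rewrite /q; lra.
(* Young's inequality on the cross term: it costs one percent of [x ^+ 2] and [100 * z ^+ 2], itself
   at most one percent of [T]. *)
have hW : 99 / 100 * D <= W.
  have := sqr_ge0 (x / 10 + 10 * z); rewrite /W /D.
  have -> : (x / 10 + 10 * z) ^+ 2 = x ^+ 2 / 100 + 2 * (x * z) + 100 * z ^+ 2.
    by field.
  have -> : (x + z) ^+ 2 = x ^+ 2 + 2 * (x * z) + z ^+ 2 by ring.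
  lra.
have hxz : (2 * x + z) ^+ 2 <= 99 / 100 * q.
  have := sqr_ge0 (x / 5 - 10 * z).
  have -> : (x / 5 - 10 * z) ^+ 2 = x ^+ 2 / 25 - 4 * (x * z) + 100 * z ^+ 2.
    by field.
  have -> : (2 * x + z) ^+ 2 = 4 * x ^+ 2 + 4 * (x * z) + z ^+ 2 by ring.
  rewrite /q /D; lra.
have key : (2 * x + z) ^+ 2 * D <= q * W.
  apply: (@le_trans _ _ (99 / 100 * q * D)); first by rewrite ler_wpM2r// ltW.
  by rewrite [_ * q]mulrC -mulrA ler_wpM2l.
have WE : W = D + (2 * x * z + z ^+ 2) by rewrite /W /D; ring.
rewrite -subr_ge0.
have -> : D^-1 - (2 * x * z + z ^+ 2) / D ^+ 2 + q * z ^+ 2 / D ^+ 3 - W^-1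
        = z ^+ 2 * (q * W - (2 * x + z) ^+ 2 * D) / (D ^+ 3 * W).
  have Wn0 : D + (2 * x * z + z ^+ 2) != 0 by rewrite -WE gt_eqF.
  by rewrite WE /q; field; rewrite Wn0/= gt_eqF.
apply: divr_ge0; first by rewrite mulr_ge0// subr_ge0.
by rewrite mulr_ge0 ?exprn_ge0// ltW.
Qed.

(* The left-hand side is the expectation of the bound [cauchy_kernel_taylor] for
   a centered [z] of variance [v]. The factor on the right is where the decay
   comes from: without it the inequality would only say that a Cauchy profile
   spreads at speed [4 v]. *)
Lemma cauchy_kernel_supersolution (R : realFieldType) (T v x : R) :
  0 < T -> 0 <= v -> 100 * (100 * v) <= T ->
  T * ((T + x ^+ 2)^-1 - v / (T + x ^+ 2) ^+ 2
       + (4 * x ^+ 2 + (T + x ^+ 2) / 10) * v / (T + x ^+ 2) ^+ 3) <=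
  (1 - 4 * v / (8 * (T + 4 * v))) * ((T + 4 * v) / (T + 4 * v + x ^+ 2)).
Proof.
move=> T0 v0 vT.
have x2 : 0 <= x ^+ 2 := sqr_ge0 x.
set D := T + x ^+ 2.
have D0 : 0 < D by rewrite /D ltr_wpDr.
have -> : x ^+ 2 = D - T by rewrite /D addrC addKr.
have TD : T <= D by rewrite /D lerDl.
have S0 : 0 < D + 4 * v by rewrite ltr_wpDr// mulr_ge0.
have V0 : 0 < T + 4 * v by rewrite ltr_wpDr// mulr_ge0.
(* The damping factor takes [v / 2] off [T + 4 * v], hence [7 / 2]. *)
have -> : (1 - 4 * v / (8 * (T + 4 * v))) * ((T + 4 * v) / (T + 4 * v + (D - T)))
   = (T + 7 / 2 * v) / (D + 4 * v).
  have n1 : T + 4 * v + (D - T) != 0 by rewrite gt_eqF//; lra.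
  by field; rewrite !gt_eqF//.
have -> : T * (D^-1 - v / D ^+ 2 + (4 * (D - T) + D / 10) * v / D ^+ 3)
   = T * (D ^+ 2 - v * D + (4 * (D - T) + D / 10) * v) / D ^+ 3.
  by field; rewrite gt_eqF//.
rewrite ler_pdivrMr ?exprn_gt0// mulrAC ler_pdivlMr// -subr_ge0.
have -> : (T + 7 / 2 * v) * D ^+ 3 -
    T * (D ^+ 2 - v * D + (4 * (D - T) + D / 10) * v) * (D + 4 * v) =
  v * (D * (7 / 2 * D ^+ 2 - 71 / 10 * (T * D) + 4 * T ^+ 2)
       - v * T * (4 * (31 / 10 * D - 4 * T))) by field.
rewrite mulr_ge0// subr_ge0.
(* The term of second order in [v], now divided by [v], is absorbed through [v <= D / 100 / 100]. *)
apply: (@le_trans _ _ (D / 100 / 100 * T * (4 * (31 / 10 * D)))).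
  apply: (@le_trans _ _ (v * T * (4 * (31 / 10 * D)))).
    by apply: ler_wpM2l; [rewrite mulr_ge0// ltW | lra].
  by apply: ler_wpM2r; [lra|apply: ler_wpM2r; [exact: ltW|lra]].
rewrite -!mulrA ler_pM2l// -subr_ge0.
(* The quadratic form in [D] and [T] is positive definite, since [(71 / 10) ^+ 2 < 4 * (7 / 2) * 4];
   completing the square shows it, with room for the small term absorbed above. *)
have := sqr_ge0 (D - 71 / 70 * T); have := sqr_ge0 T.
have -> : (D - 71 / 70 * T) ^+ 2 =
   D ^+ 2 - 71 / 35 * (T * D) + 5041 / 4900 * T ^+ 2 by field.
have : T * D <= D ^+ 2 by rewrite expr2 ler_wpM2r// ltW.
have : T ^+ 2 <= T * D by rewrite expr2 ler_wpM2l// ltW.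
nra.
Qed.

(** Bernoulli's inequality [1 + y <= (1 + y / 8) ^+ 8], obtained by three squarings, leaves
    [(1 - (y / 8) ^+ 2) ^+ 8 <= 1]. With [y = s / (T + s)] this makes the 8th powers of the damping
    factors telescope. *)
Lemma expr8_contraction (R : realFieldType) (y : R) :
  0 <= y <= 1 -> (1 - y / 8) ^+ 8 * (1 + y) <= 1.
Proof.
move=> /andP[y0 y1].
have h : 1 + y <= (1 + y / 8) ^+ 8.
  have b (u : R) : 0 <= u -> 1 + 2 * u <= (1 + u) ^+ 2.
    by move=> u0; rewrite sqrrD expr1n mul1r mulr_natl lerDl sqr_ge0.
  have e (u : R) : u ^+ 8 = ((u ^+ 2) ^+ 2) ^+ 2 by rewrite -!exprM.
  have m (a c : R) : 0 <= a -> a <= c -> a ^+ 2 <= c ^+ 2.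
    by move=> a0 ac; rewrite lerXn2r// nnegrE// (le_trans a0).
  rewrite e; apply: le_trans (m (1 + y / 2) _ _ _); [|lra|].
    by apply: le_trans (b _ _); lra.
  apply: le_trans (m (1 + y / 4) _ _ _); [|lra|].
    by apply: le_trans (b _ _); lra.
  by apply: le_trans (b _ _); lra.
apply: (@le_trans _ _ ((1 - y / 8) ^+ 8 * (1 + y / 8) ^+ 8)).
  by rewrite ler_wpM2l// exprn_ge0//; lra.
rewrite -exprMn; have -> : (1 - y / 8) * (1 + y / 8) = 1 - (y / 8) ^+ 2 by ring.
rewrite exprn_ile1//; have : 0 <= (y / 8) ^+ 2 by rewrite sqr_ge0.
  have : (y / 8) ^+ 2 <= 1 by rewrite expr_le1//; lra.
  lra.
lra.
Qed.

(** * Independence of a partial sum and the next observation *)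

Lemma independent_initial_segment (R : realType) (d : nat)
    (dO : measure_display) (Omega : measurableType dO)
    (Pr : probability Omega R) (X : nat -> {RV Pr >-> euclidean R d})
    (n : nat) (A : nat -> set (euclidean R d)) :
  mutually_independent X -> (forall i, measurable (A i)) ->
  Pr (\bigcap_(i in `I_n) X i @^-1` A i) =
  (\prod_(0 <= i < n) Pr (X i @^-1` A i))%E.
Proof.
move=> indX mA; pose J := [fset i in iota 0 n]%fset.
have -> : `I_n = [set` J].
  by apply/seteqP; split => i /=; rewrite in_fset/= mem_iota add0n.
rewrite indX// /index_iota subn0; apply: perm_big; apply: uniq_perm.
- exact: fset_uniq.
- exact: iota_uniq.
- by move=> i; rewrite in_fset.
Qed.

Lemma measurable_RV_preimage (R : realType) (dO dT : measure_display)
    (Omega : measurableType dO) (T : measurableType dT)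
    (Pr : probability Omega R) (X : {RV Pr >-> T}) (A : set T) :
  measurable A -> measurable (X @^-1` A).
Proof. by move=> mA; rewrite -[_ @^-1` _]setTI; exact: measurable_funP. Qed.

(* Both sides are measures in the event on the first [n] observations, and they
   agree on the pi-system of the rectangles in these observations. *)
Lemma sum_next_independent (R : realType) (d : nat)
    (dO : measure_display) (Omega : measurableType dO)
    (Pr : probability Omega R) (X : nat -> {RV Pr >-> euclidean R d})
    (Z : euclidean R d -> R) (n : nat) (A : set R) (B : set (euclidean R d)) :
  mutually_independent X -> measurable_fun setT Z ->
  measurable A -> measurable B ->
  Pr ([set w | A (\sum_(i < n) Z (X i w))%R] `&` X n @^-1` B) =
  (Pr [set w | A (\sum_(i < n) Z (X i w))%R] * Pr (X n @^-1` B))%E.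
Proof.
move=> indX mZ mA mB.
pose G : set (set Omega) := [set C | exists2 F : nat -> set (euclidean R d),
  (forall i, measurable (F i)) & C = \bigcap_(i in `I_n) X i @^-1` F i].
have mXB : measurable (X n @^-1` B) by exact: measurable_RV_preimage.
have GX i F : (i < n)%N -> measurable F -> G (X i @^-1` F).
  move=> ni mF; exists (fun j => if j == i then F else setT).
    by move=> j; case: ifP.
  apply/seteqP; split => [w Fw j/= nj|w /(_ i ni)]; last by rewrite /= eqxx.
  by case: eqP => // ->.
have mG : G `<=` measurable.
  move=> _ [F mF ->]; rewrite bigcap_mkord; apply: bigsetI_measurable => i _.
  exact: measurable_RV_preimage.
have setIG : setI_closed G.
  move=> _ _ [F mF ->] [F' mF' ->]; exists (fun i => F i `&` F' i).
    by move=> i; exact: measurableI.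
  by rewrite -bigcapI.
have GT : G setT.
  by exists (fun=> setT) => //; apply/seteqP; split.
pose p := NngNum (fine_ge0 (measure_ge0 Pr (X n @^-1` B))).
have pE : (p%:num%:E = Pr (X n @^-1` B))%E by rewrite /= fineK// fin_num_measure.
have eqG C : G C -> mrestr Pr mXB C = mscale p Pr C.
  move=> [F mF ->]; rewrite /mrestr /mscale/= -/(p%:num) pE muleC.
  rewrite independent_initial_segment//.
  pose F' i := if i == n then B else F i.
  have -> : \bigcap_(i in `I_n) X i @^-1` F i `&` X n @^-1` B =
            \bigcap_(i in `I_n.+1) X i @^-1` F' i.
    apply/seteqP; split => [w [Fw Bw] i/=|w Fw].
      rewrite ltnS leq_eqVlt /F' => /orP[/eqP -> |ni]; first by rewrite eqxx.
      by rewrite ltn_eqF//; exact: Fw.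
    split; last by have := Fw n; rewrite /F' /= eqxx ltnSn; exact.
    by move=> i/= ni; have := Fw i; rewrite /F' /= ltn_eqF//; apply; rewrite ltnS ltnW.
  rewrite independent_initial_segment//; last first.
    by move=> i; rewrite /F'; case: ifP.
  rewrite big_nat_recr//= /F' eqxx; congr (_ * _)%E.
  by rewrite big_nat [RHS]big_nat; apply: eq_bigr => i ni; rewrite ltn_eqF.
(* The sum is measurable for the sigma-algebra of the first [n] observations alone, so its events
   are among those on which the two measures agree. *)
have mS : measurable_fun setT
    (fun w : g_sigma_algebraType G => \sum_(i < n) Z (X i w)).
  apply: measurable_sum => i; apply: (measurableT_comp mZ) => _ F mF.
  by rewrite setTI; apply: sub_sigma_algebra; exact: GX.
have := g_sigma_algebra_measure_unique G mG (fun=> setT) (fun=> GT) _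
  (mrestr Pr mXB) (mscale p Pr) setIG eqG.
rewrite bigcup_const// => /(_ erefl); rewrite /mrestr/= /mscale/= -/(p%:num) pE.
rewrite muleC; apply.
  move=> _; apply: (le_lt_trans (probability_le1 _ _) (ltry _)).
  exact: measurableI.
by rewrite -[X in <<s G >> X]setTI; exact: mS.
Qed.

(** * Averaging the Cauchy kernel over one bounded step *)

Lemma bounded_integrable (R : realType) (dT : measure_display)
    (T : measurableType dT) (P : probability T R) (f : T -> R) (M : R) :
  measurable_fun setT f -> (forall x, `|f x| <= M) ->
  P.-integrable setT (EFin \o f).
Proof.
move=> mf fM; apply: measurable_bounded_integrable => //.
  exact: le_lt_trans (probability_le1 P measurableT) (ltry 1).
by exists M; split; [exact: num_real|move=> r Mr x _; exact: le_trans (ltW Mr)].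
Qed.

Lemma Rintegral_probability_cst (R : realType) (dT : measure_display)
    (T : measurableType dT) (P : probability T R) (r : R) : \int[P]_x r = r.
Proof.
rewrite Rintegral_cst//.
exact: etrans (congr1 (fun u => r * fine u) (probability_setT P)) (mulr1 r).
Qed.

Lemma measurable_cauchy_kernel (R : realType) (T : R) : 0 < T ->
  measurable_fun setT (fun u : R => T / (T + u ^+ 2)).
Proof.
move=> T0; apply: continuous_measurable_fun => u.
apply: cvgM; first exact: cvg_cst.
apply: cvgV; first by rewrite gt_eqF// ltr_wpDr// sqr_ge0.
by apply: cvgD; [exact: cvg_cst|exact: exprn_continuous].
Qed.

Lemma cauchy_kernel_ge0 (R : realType) (T u : R) :
  0 < T -> 0 <= T / (T + u ^+ 2).
Proof. by move=> T0; rewrite divr_ge0 ?addr_ge0 ?sqr_ge0 ?ltW. Qed.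

Lemma cauchy_kernel_le1 (R : realType) (T u : R) :
  0 < T -> T / (T + u ^+ 2) <= 1.
Proof.
by move=> T0; rewrite ler_pdivrMr ?mul1r ?lerDl ?sqr_ge0 ?ltr_wpDr ?sqr_ge0.
Qed.

Lemma Rintegral_sqr_le (R : realType) (dT : measure_display)
    (T : measurableType dT) (P : probability T R) (Z : T -> R) (M : R) :
  measurable_fun setT Z -> (forall y, `|Z y| <= M) ->
  \int[P]_y (Z y ^+ 2) <= M ^+ 2.
Proof.
move=> mZ ZM; have Z2M y : `|Z y ^+ 2| <= M ^+ 2.
  by rewrite normrX lerXn2r// nnegrE// (le_trans _ (ZM y)).
have -> : M ^+ 2 = \int[P]_y (M ^+ 2) :> R by rewrite Rintegral_probability_cst.
apply: le_Rintegral => //; last first.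
- by move=> y _; apply: le_trans (Z2M y); exact: ler_norm.
- exact: finite_measure_integrable_cst.
- by apply: bounded_integrable Z2M; exact: measurable_funX.
Qed.

Lemma cauchy_kernel_step (R : realType) (dT : measure_display)
    (E : measurableType dT) (P : probability E R) (Z : E -> R) (M T v x : R) :
  measurable_fun setT Z -> (forall y, `|Z y| <= M) ->
  \int[P]_y Z y = 0 -> \int[P]_y (Z y ^+ 2) = v ->
  0 < T -> 100 * (100 * M ^+ 2) <= T ->
  (\int[P]_y (T / (T + (x + Z y) ^+ 2))%:E <=
   ((1 - 4 * v / (8 * (T + 4 * v))) *
     ((T + 4 * v) / (T + 4 * v + x ^+ 2)))%:E)%E.
Proof.
move=> mZ ZM Z0 vE T0 MT.
have mZ2 : measurable_fun setT (fun y => Z y ^+ 2) by exact: measurable_funX.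
have Z2M y : `|Z y ^+ 2| <= M ^+ 2.
  by rewrite normrX lerXn2r// nnegrE// (le_trans _ (ZM y)).
have iZ := bounded_integrable P mZ ZM.
have iZ2 := bounded_integrable P mZ2 Z2M.
have v0 : 0 <= v by rewrite -vE; apply: Rintegral_ge0 => y _; exact: sqr_ge0.
have vM : v <= M ^+ 2 by rewrite -vE; exact: Rintegral_sqr_le.
set D := T + x ^+ 2.
(* The Taylor bound sorted by powers of [Z y]; the linear term integrates to 0 because the step is
   centered. *)
pose a := T * D^-1.
pose b := - (T * (2 * x) / D ^+ 2).
pose c := T * ((4 * x ^+ 2 + D / 10) / D ^+ 3 - (D ^+ 2)^-1).
have iF : P.-integrable setT
    (EFin \o (fun y => T / (T + (x + Z y) ^+ 2))).
  apply: (@bounded_integrable _ _ _ _ _ 1).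
    apply: (measurableT_comp (measurable_cauchy_kernel T0)).
    exact: measurable_funD.
  by move=> y; rewrite ger0_norm ?cauchy_kernel_le1 ?cauchy_kernel_ge0.
have ibZ : P.-integrable setT (EFin \o (fun y => b * Z y)).
  by have := integrableZl measurableT b iZ.
have icZ : P.-integrable setT (EFin \o (fun y => c * Z y ^+ 2)).
  by have := integrableZl measurableT c iZ2.
have ia : P.-integrable setT (EFin \o (fun y : E => a)).
  exact: finite_measure_integrable_cst.
have iab : P.-integrable setT (EFin \o (fun y => a + b * Z y)).
  by have := integrableD measurableT ia ibZ.
have iabc : P.-integrable setT (EFin \o (fun y => a + b * Z y + c * Z y ^+ 2)).
  by have := integrableD measurableT iab icZ.
have -> : (\int[P]_y (T / (T + (x + Z y) ^+ 2))%:E)%E =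
          (\int[P]_y (T / (T + (x + Z y) ^+ 2)))%:E.
  by rewrite /Rintegral fineK//; exact: integrable_fin_num iF.
rewrite lee_fin; apply: le_trans (cauchy_kernel_supersolution x T0 v0 _); last first.
  by apply: le_trans MT; rewrite !ler_wpM2l ?ler0n.
apply: (@le_trans _ _ (\int[P]_y (a + b * Z y + c * Z y ^+ 2))).
  apply: le_Rintegral => // y _.
  apply: le_trans (cauchy_kernel_taylor _ T0 MT (ZM y)) _.
  rewrite le_eqVlt; apply/orP; left; apply/eqP; rewrite /a /b /c -/D.
  by field; rewrite gt_eqF// ltr_wpDr// sqr_ge0.
rewrite (RintegralD measurableT iab icZ) (RintegralD measurableT ia ibZ).
rewrite (RintegralZl b measurableT iZ) (RintegralZl c measurableT iZ2).
rewrite Z0 vE.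
rewrite Rintegral_probability_cst.
rewrite le_eqVlt; apply/orP; left; apply/eqP; rewrite /a /b /c -/D.
by field; rewrite gt_eqF// ltr_wpDr// sqr_ge0.
Qed.

(** * Sums of independent steps and their anticoncentration *)

(** Independence makes the joint law of the partial sum and the next observation a product measure,
    by uniqueness; Tonelli's theorem then freezes the sum while the new observation is averaged. *)
Lemma integral_sum_next (R : realType) (d : nat)
    (dO : measure_display) (Omega : measurableType dO)
    (Pr : probability Omega R) (X : nat -> {RV Pr >-> euclidean R d})
    (P : probability (euclidean R d) R)
    (Z : euclidean R d -> R) (n : nat) (f : R * euclidean R d -> \bar R) :
  iid X P -> measurable_fun setT Z ->
  measurable_fun setT f -> (forall u, 0 <= f u)%E ->
  (\int[Pr]_w f ((\sum_(i < n) Z (X i w))%R, X n w) =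
   \int[Pr]_w \int[P]_y f ((\sum_(i < n) Z (X i w))%R, y))%E.
Proof.
move=> [indX lawX] mZ mf f0.
have mS : measurable_fun setT (fun w => \sum_(i < n) Z (X i w)).
  by apply: measurable_sum => i; exact: measurableT_comp.
pose S : {RV Pr >-> R} := mfun_Sub (mem_set mS).
have mSX : measurable_fun setT (fun w => (S w, X n w)).
  by apply: measurable_fun_pair => //; exact: measurable_funP.
transitivity (\int[pushforward Pr (fun w => (S w, X n w))]_u f u)%E.
  by rewrite ge0_integral_pushforward.
transitivity (\int[distribution Pr S \x P]_u f u)%E.
  apply: eq_measure_integral => C mC _; apply/esym.
  apply: product_measure_unique mC => A B mA mB.
  apply: etrans (sum_next_independent n indX mZ mA mB) _.
  by congr (_ * _)%E; exact: lawX.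
rewrite fubini_tonelli1// ge0_integral_distribution//.
- by apply: measurable_fun_fubini_tonelli_F.
- by move=> y; exact: integral_ge0.
Qed.

(** Averaging out the last summand turns [T] into [T + s], so the induction is uniform in [T]. The
    bound [b] is controlled through its 8th power because that is what telescopes; with [n.+1] both
    sides coincide for [n = 0] and [b = 1]. *)
Lemma cauchy_kernel_sum (R : realType) (d : nat)
    (dO : measure_display) (Omega : measurableType dO)
    (Pr : probability Omega R) (X : nat -> {RV Pr >-> euclidean R d})
    (P : probability (euclidean R d) R)
    (Z : euclidean R d -> R) (M v : R) (n : nat) (T : R) :
  iid X P -> measurable_fun setT Z -> (forall y, `|Z y| <= M) ->
  \int[P]_y Z y = 0 -> \int[P]_y (Z y ^+ 2) = v ->
  0 < T -> 100 * (100 * M ^+ 2) <= T ->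
  exists2 b, 0 <= b /\ b ^+ 8 * (T + n.+1%:R * (4 * v)) <= T + 4 * v &
    (\int[Pr]_w (T / (T + (\sum_(i < n) Z (X i w)) ^+ 2))%:E <= b%:E)%E.
Proof.
move=> iidX mZ ZM Z0 vE; set s := 4 * v.
have v0 : 0 <= v by rewrite -vE; apply: Rintegral_ge0 => y _; exact: sqr_ge0.
have s0 : 0 <= s by rewrite mulr_ge0.
have mS k : measurable_fun setT (fun w => \sum_(i < k) Z (X i w)).
  by apply: measurable_sum => i; exact: measurableT_comp.
elim: n T => [|n IHn] T T0 MT.
  exists 1; first by rewrite expr1n !mul1r.
  apply: (@le_trans _ _ (\int[Pr]_w (cst 1%E w))%E); last first.
    by rewrite integral_cst// mul1e probability_le1.
  rewrite le_eqVlt; apply/orP; left; apply/eqP; apply: eq_integral => w _ /=.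
  by rewrite big_ord0 expr0n/= addr0 divff ?gt_eqF.
have Ts0 : 0 < T + s by rewrite ltr_wpDr.
have [|b [b0 bT] leb] := IHn (T + s) Ts0; first by rewrite (le_trans MT) ?lerDl.
set c := 1 - s / (8 * (T + s)).
pose y := s / (T + s).
have y01 : 0 <= y <= 1.
  by rewrite /y divr_ge0 ?(ltW Ts0)//= ler_pdivrMr// mul1r lerDr ltW.
have cE : c = 1 - y / 8 by rewrite /c /y invfM mulrCA mulrC mulrAC.
have c0 : 0 <= c by rewrite cE; lra.
exists (c * b).
  split; first exact: mulr_ge0.
  (* The induction hypothesis at [T + s] leaves [T + s + s] on the right; the factor [c ^+ 8] brings
     it back to [T + s]. *)
  have yE : T + s + s = (1 + y) * (T + s).
    by rewrite /y mulrDl mul1r divfK ?gt_eqF.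
  rewrite exprMn -mulrA.
  apply: (@le_trans _ _ (c ^+ 8 * (T + s + s))).
    rewrite ler_wpM2l ?exprn_ge0//; apply: le_trans bT.
    rewrite ler_wpM2l ?exprn_ge0// -(addrA T) lerD2l.
    by rewrite [n.+2%:R]mulrS mulrDl mul1r.
  rewrite yE mulrA -[leRHS]mul1r ler_wpM2r ?(ltW Ts0)// cE.
  exact: expr8_contraction.
pose f (u : R * euclidean R d) := (T / (T + (u.1 + Z u.2) ^+ 2))%:E.
have mf : measurable_fun setT f.
  apply/measurable_EFinP; apply: (measurableT_comp (measurable_cauchy_kernel T0)).
  by apply: measurable_funD => //; exact: measurableT_comp.
have f0 u : (0 <= f u)%E by rewrite lee_fin cauchy_kernel_ge0.
have mk : measurable_fun setT
    (fun w => ((T + s) / (T + s + (\sum_(i < n) Z (X i w)) ^+ 2))%:E).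
  apply/measurable_EFinP.
  exact: (measurableT_comp (measurable_cauchy_kernel Ts0)).
have k0 w : (0 <= ((T + s) / (T + s + (\sum_(i < n) Z (X i w)) ^+ 2))%:E)%E.
  by rewrite lee_fin cauchy_kernel_ge0.
rewrite (_ : (\int[Pr]_w _)%E =
    (\int[Pr]_w f ((\sum_(i < n) Z (X i w))%R, X n w))%E); last first.
  by apply: eq_integral => w _; rewrite big_ord_recr.
rewrite (integral_sum_next n iidX mZ mf f0) EFinM.
apply: le_trans (lee_wpmul2l _ leb); last by rewrite lee_fin.
rewrite -ge0_integralZl_EFin//; apply: ge0_le_integral => //.
- by move=> w _; exact: integral_ge0.
- apply: (measurableT_comp (f := fun x => (\int[P]_y f (x, y))%E) _ (mS n)).
  by apply: measurable_fun_fubini_tonelli_F.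
- exact: measurable_funeM.
- move=> w _; rewrite -EFinM.
  exact: (cauchy_kernel_step _ mZ ZM Z0 vE T0 MT).
Qed.

(** Markov's inequality: on the event, the kernel with [T = 100 * (100 * M ^+ 2) + L ^+ 2] is at
    least one half, so the probability is at most [2 * b]. In the constant 512, a factor 256 is the
    8th power of this 2, and the other 2 comes from [T + s <= 2 * T]. *)
Lemma sum_anticoncentration (R : realType) (d : nat)
    (dO : measure_display) (Omega : measurableType dO)
    (Pr : probability Omega R) (X : nat -> {RV Pr >-> euclidean R d})
    (P : probability (euclidean R d) R)
    (Z : euclidean R d -> R) (M L eps : R) (n : nat) :
  iid X P -> measurable_fun setT Z -> (forall y, `|Z y| <= M) -> 0 < M ->
  \int[P]_y Z y = 0 -> 0 <= eps ->
  512 * (100 * (100 * M ^+ 2) + L ^+ 2) <=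
    eps ^+ 8 * (n%:R * (4 * \int[P]_y (Z y ^+ 2))) ->
  (Pr [set w | (`|\sum_(i < n) Z (X i w)| < L)%R] <= eps%:E)%E.
Proof.
move=> iidX mZ ZM M0 Z0 eps0; set v := \int[P]_y (Z y ^+ 2) => hL.
have vM : v <= M ^+ 2 by exact: Rintegral_sqr_le.
have M2 : 0 < M ^+ 2 by rewrite exprn_gt0.
have L2 : 0 <= L ^+ 2 by exact: sqr_ge0.
set T := 100 * (100 * M ^+ 2) + L ^+ 2 in hL.
have T0 : 0 < T by rewrite /T; lra.
have MT : 100 * (100 * M ^+ 2) <= T by rewrite /T lerDl.
have [b [b0 bT] leb] := cauchy_kernel_sum n iidX mZ ZM Z0 erefl T0 MT.
have v0 : 0 <= v by apply: Rintegral_ge0 => y _; exact: sqr_ge0.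
set s := 4 * v in hL bT.
have s0 : 0 <= s by rewrite mulr_ge0.
have ns0 : 0 < n%:R * s.
  rewrite lt_neqAle mulr_ge0// andbT; apply/eqP => ns0.
  by move: hL; rewrite -ns0 mulr0; lra.
have hb : 2 * b <= eps.
  rewrite -(@ler_pXn2r _ 8)// ?nnegrE ?mulr_ge0//.
  rewrite -(ler_pM2r ns0); apply: le_trans hL.
  have -> : (2 * b) ^+ 8 * (n%:R * s) = 256 * (b ^+ 8 * (n%:R * s)).
    by ring.
  have : b ^+ 8 * (n%:R * s) <= T + s.
    apply: le_trans bT; rewrite ler_wpM2l ?exprn_ge0//.
    by rewrite -natr1 mulrDl mul1r addrCA lerDl addr_ge0// ltW.
  have : s <= T by rewrite /s /T; lra.
  lra.
have mS : measurable_fun setT (fun w => \sum_(i < n) Z (X i w)).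
  by apply: measurable_sum => i; exact: measurableT_comp.
set A := [set w | _].
have mA : measurable A.
  rewrite (_ : A = setT `&` (fun w => `|\sum_(i < n) Z (X i w)|) @^-1` `]-oo, L[).
    by apply: (measurableT_comp (@normr_measurable _ setT) mS) => //.
  by rewrite setTI; apply/seteqP; split => w /=; rewrite in_itv.
set F : Omega -> \bar R := fun w => _ in leb.
have mF : measurable_fun setT F.
  apply/measurable_EFinP.
  exact: (measurableT_comp (measurable_cauchy_kernel T0)).
have F0 w : (0 <= F w)%E by rewrite lee_fin cauchy_kernel_ge0.
have hA : ((2^-1)%:E * Pr A <= b%:E)%E.
  apply: le_trans leb; rewrite -integral_cst//.
  apply: (@le_trans _ _ (\int[Pr]_(w in A) F w)%E); last first.
    exact: ge0_subset_integral.
  apply: ge0_le_integral => //.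
  - by move=> w _; rewrite lee_fin.
  - exact: measurable_funTS.
  - move=> w; rewrite /A/= => Sw; rewrite lee_fin ler_pdivlMr; last first.
      by rewrite ltr_wpDr// sqr_ge0.
    have : (\sum_(i < n) Z (X i w)) ^+ 2 <= L ^+ 2.
      rewrite -[leLHS]real_normK ?num_real// lerXn2r ?nnegrE//.
        exact: le_trans (normr_ge0 _) (ltW Sw).
      exact: ltW.
    rewrite /T; lra.
have fA : Pr A \is a fin_num by exact: fin_num_measure.
move: hA; rewrite -(fineK fA) -EFinM !lee_fin => hA.
by apply: le_trans hb; lra.
Qed.

(** * Right neighborhoods, extended reals and Euclidean geometry *)

Lemma near_at_right0 (R : realType) (A : set R) :
  (\forall r \near 0^'+, A r) -> exists2 e, 0 < e & forall r, 0 < r < e -> A r.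
Proof.
case=> e /= e0 eA; exists e => // r /andP[r0 re]; apply: eA => //=.
by rewrite sub0r normrN gtr0_norm.
Qed.

Lemma gte0_real_le (R : realType) (x : \bar R) :
  (0 < x)%E -> exists2 k : R, 0 < k & (k%:E <= x)%E.
Proof.
by case: x => [r r0||//]; [exists r|exists 1; rewrite ?leey].
Qed.

Lemma lty_real_ge (R : realType) (x : \bar R) :
  (x < +oo)%E -> exists2 k : R, 0 < k & (x <= k%:E)%E.
Proof.
case: x => [r _|//|_]; last by exists 1; rewrite ?leNye.
by exists (Num.max 1 r); rewrite ?lee_fin ?le_max ?lexx ?orbT// lt_max ltr01.
Qed.

Section euclidean_geometry.
Context {R : realType} {d : nat}.
Implicit Types x y : euclidean R d.

Lemma enormZ (a : R) x : enorm (a *: x) = `|a| * enorm x.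
Proof.
rewrite /enorm -sqrtr_sqr -sqrtrM ?sqr_ge0// mulr_sumr; congr (Num.sqrt _).
by apply: eq_bigr => j _; rewrite mxE exprMn.
Qed.

Lemma enormBC x y : enorm (x - y) = enorm (y - x).
Proof.
rewrite /enorm; congr (Num.sqrt _); apply: eq_bigr => j _.
by rewrite !mxE -sqrrN opprB.
Qed.

Lemma continuous_measurable_euclidean (f : 'rV[R]_d -> 'rV[R]_d) :
  continuous f ->
  measurable_fun setT (f : euclidean R d -> euclidean R d).
Proof.
move=> cf; apply: (@measurability _ _ (euclidean R d) (euclidean R d) setT f
  (@open 'rV[R]_d)) => // _ [U oU <-].
by rewrite setTI; apply: sub_sigma_algebra; apply: open_comp.
Qed.

(** The topology is that of the max norm; continuity of [enorm] for it is what makes Euclidean balls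
    open, hence Borel. *)
Lemma enorm_continuous : continuous (enorm : 'rV[R]_d -> R).
Proof.
move=> x; apply: (@continuous_comp _ _ _ (fun y : 'rV[R]_d =>
  \sum_(j < d) y ord0 j ^+ 2) Num.sqrt); last exact: sqrt_continuous.
apply: (@cvg_big _ _ _ _ _ add_continuous _ _ _
  (fun j (y : 'rV[R]_d) => y ord0 j ^+ 2) (fun j => x ord0 j ^+ 2)).
  exact: nbhs_filter.
move=> j _.
 apply: (@continuous_comp _ _ _ (fun y : 'rV[R]_d => y ord0 j)
  (fun u : R => u ^+ 2)); first exact: coord_continuous.
exact: exprn_continuous.
Qed.

Lemma measurable_eball x r : measurable (eball x r).
Proof.
apply: sub_sigma_algebra.
have -> : eball x r =
    (fun y : 'rV[R]_d => enorm (y - x : 'rV[R]_d)) @^-1` [set u | u < r].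
  by [].
apply: open_comp; last exact: (@open_lt R r).
move=> y _; apply: (@continuous_comp _ _ _ (fun y : 'rV[R]_d => y - x) enorm).
  exact: (@cvgB R 'rV[R]_d _ _ (nbhs_filter y) id (cst x) y x cvg_id (cvg_cst x)).
exact: enorm_continuous.
Qed.

Lemma measurable_rescale (h : R) x :
  measurable_fun setT (fun y : euclidean R d => h^-1 *: (x - y)).
Proof.
apply: continuous_measurable_euclidean => y.
have xy : (fun u : 'rV[R]_d => (x : 'rV[R]_d) - u) @ nbhs y --> (x : 'rV[R]_d) - y.
  exact: (@cvgB R 'rV[R]_d _ _ (nbhs_filter y) (cst x) id x y (cvg_cst x) cvg_id).
exact: (@cvgZl_tmp R 'rV[R]_d _ _ (nbhs_filter y) h^-1 _ _ xy).
Qed.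

End euclidean_geometry.

(** * Masses of small balls *)

Lemma ball_mass_lower (R : realType) (d : nat) (XX : set (euclidean R d))
    (P : probability (euclidean R d) R) (nu : R) :
  (0 < ereal_sup [set limf_einf (fun r : R =>
     P (eball x r) / (r `^ nu)%:E) 0^'+ | x in XX])%E ->
  exists x, XX x /\ exists c r0 : R, [/\ 0 < c, 0 < r0 & forall r, 0 < r < r0 ->
    ((c * r `^ nu)%:E <= P (eball x r))%E].
Proof.
move=> /ereal_sup_gt[_ [x Xx <-]]; rewrite limf_einfE.
move=> /ereal_sup_gt[_ [V V0 <-]] /gte0_real_le[c c0 cV].
have [r0 r00 Vr0] := near_at_right0 V0.
exists x; split => //; exists c, r0; split => // r rr0.
have r_gt0 : 0 < r `^ nu by rewrite powR_gt0//; case/andP: rr0.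
have : (c%:E <= P (eball x r) / (r `^ nu)%:E)%E.
  apply: le_trans cV _; apply: ereal_inf_lbound.
  by exists r => //; exact: Vr0.
by rewrite inver gt_eqF// lee_pdivlMr.
Qed.

(** A positive dimension provides some exponent [nu > 0] for which the mass is at most [C] times the
    [nu]-th power of the radius, so [x] is not an atom. Only smallness is wanted, hence any such
    [nu] will do. *)
Lemma ball_mass_upper (R : realType) (d : nat) (XX : set (euclidean R d))
    (P : probability (euclidean R d) R) (x : euclidean R d) (eps : R) :
  (0 < volume_dimension XX P)%E -> XX x -> 0 < eps ->
  exists2 r0 : R, 0 < r0 & forall r, 0 < r < r0 -> (P (eball x r) <= eps%:E)%E.
Proof.
move=> /ereal_sup_gt[_ [nu [nu0 supnu] <-]]; rewrite lte_fin => nu_gt0.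
move=> Xx eps0; move: supnu => /ereal_inf_lt[_ [V V0 <-]] /lty_real_ge[C C0 VC].
have [r0 r00 Vr0] := near_at_right0 V0.
(* The radius at which [C] times the [nu]-th power equals [eps]. *)
pose r1 := (eps / C) `^ nu^-1.
have r10 : 0 < r1 by rewrite powR_gt0// divr_gt0.
exists (Num.min r0 r1); first by rewrite lt_min r00.
move=> r /andP[r_gt0]; rewrite lt_min => /andP[rr0 rr1].
have r_nu : 0 < r `^ nu by rewrite powR_gt0.
have : (P (eball x r) / (r `^ nu)%:E <= C%:E)%E.
  apply: le_trans VC; apply: (@le_trans _ _ (ereal_sup
      [set P (eball x r) / (r `^ nu)%:E | x in XX]%E)).
    by apply: ereal_sup_ubound; exists x.
  by apply: ereal_sup_ubound; exists r => //; apply: Vr0; rewrite r_gt0.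
rewrite inver gt_eqF// lee_pdivrMr// => /le_trans; apply.
rewrite -EFinM lee_fin mulrC -ler_pdivlMr//.
have -> : eps / C = r1 `^ nu.
  by rewrite /r1 -powRrM mulVf ?gt_eqF// powRr1// divr_ge0// ltW.
by rewrite ge0_ler_powR// ?nnegrE ltW.
Qed.

(** * Pointwise consequences of the conditions on the kernel *)

(** The integral of a nonnegative function is a supremum over the simple functions below it, hence
    monotone without measurability. This spares a measurability proof for [sup_outside K]. *)
Lemma ge0_le_integral_nonmeasurable (R : realType) (dT : measure_display)
    (T : measurableType dT) (mu : {measure set T -> \bar R}) (D : set T)
    (f g : T -> \bar R) :
  (forall x, D x -> 0 <= f x)%E -> (forall x, D x -> f x <= g x)%E ->
  (\int[mu]_(x in D) f x <= \int[mu]_(x in D) g x)%E.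
Proof.
move=> f0 fg; have g0 x : D x -> (0 <= g x)%E.
  by move=> Dx; apply: le_trans (f0 x Dx) (fg x Dx).
rewrite !ge0_integralE//; apply: ereal_sup_le => _ [k kf <-].
exists k => // x; apply: le_trans (kf x) _; rewrite /patch; case: ifPn => //.
by rewrite inE => /fg.
Qed.

Section kernel.
Context {R : realType} {d : nat} (K : euclidean R d -> R).

Lemma sup_norm_bound : (sup_norm K < +oo)%E ->
  exists2 M : R, 0 < M & forall z, `|K z| <= M.
Proof.
move=> /lty_real_ge[M M0 KM]; exists M => // z; rewrite -lee_fin.
by apply: le_trans KM; apply: ereal_sup_ubound; exists z.
Qed.

Lemma kernel_positive_near0 : (0 < lim (inf_inside K t @[t --> 0^'+]))%E ->
  exists t k : R, [/\ 0 < t, 0 < k & forall z, enorm z <= t -> k <= K z].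
Proof.
move=> K0.
(* The value of [lim] only carries information once convergence is known; here it follows from
   monotonicity in [t]. *)
have cvgK : cvg (inf_inside K t @[t --> 0^'+]).
  apply: nonincreasing_at_right_is_cvge; near=> r => s t _ _ st.
  apply: ereal_inf_le_tmp => _ [z zs <-]; exists z => //=.
  exact: le_trans zs st.
have [t [t0 Kt]] : exists t, 0 < t /\ (0 < inf_inside K t)%E.
  apply: contrapT => /forallNP nK; move: K0; apply/negP; rewrite -leNgt.
  apply: lime_le => //; near=> t; rewrite leNgt; apply/negP => Kt.
  by apply: (nK t); split.
have [k k0 kK] := gte0_real_le Kt.
exists t, k; split => // z zt; rewrite -lee_fin; apply: le_trans kK _.
by apply: ereal_inf_lbound; exists z.
Unshelve. all: by end_near. Qed.

(* Otherwise the integrand is at least [eps (a ^ nu) / (2 a)] on [(a, 2 a)], which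
   contributes [eps (a ^ nu) / 2] to the integral. *)
Lemma kernel_decay (nu eps : R) :
  (\int[lebesgue_measure]_(t in `]0%R, +oo[)
     ((t `^ (nu - 1))%:E * sup_outside K t) < +oo)%E ->
  0 < nu -> 0 < eps ->
  exists2 t : R, 0 < t & forall z, t <= enorm z -> `|K z| <= eps.
Proof.
move=> /lty_real_ge[C C0 intC] nu0 eps0.
(* Chosen so that the contribution of []a, 2 * a[] is [C + eps / 2], more than the bound [C] on the
   whole integral. *)
pose a := (2 * (C / eps) + 1) `^ nu^-1.
have B0 : 0 < 2 * (C / eps) + 1.
  by rewrite ltr_wpDl// mulr_ge0// divr_ge0// ltW.
have a0 : 0 < a by rewrite powR_gt0.
have aE : a `^ nu = 2 * (C / eps) + 1.
  by rewrite /a -powRrM mulVf ?gt_eqF// powRr1// ltW.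
exists (2 * a); first by rewrite mulr_gt0.
move=> z az; rewrite leNgt; apply/negP => Kz.
suff : ((eps / 2 * a `^ nu)%:E <= C%:E)%E.
  rewrite aE lee_fin leNgt => /negP; apply.
  have -> : eps / 2 * (2 * (C / eps) + 1) = C + eps / 2.
    by field; rewrite gt_eqF.
  by rewrite ltrDl divr_gt0.
apply: le_trans intC.
pose c := eps * (a `^ nu / (2 * a)).
have c0 : 0 <= c.
  rewrite mulr_ge0 ?(ltW eps0)// divr_ge0 ?powR_ge0//.
  by rewrite mulr_ge0 ?(ltW a0).
have a2a : a < 2 * a by rewrite ltr_pMl// ltr1n.
have lebesgue_a2a : lebesgue_measure (`]a, 2 * a[%classic : set R) = a%:E.
  rewrite lebesgue_measure_itv/= lte_fin a2a -EFinB; congr EFin; ring.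
have -> : ((eps / 2 * a `^ nu)%:E =
    \int[lebesgue_measure]_(t in `]0%R, +oo[) (c * \1_`]a, 2 * a[ t)%:E :> \bar R)%E.
  under eq_integral do rewrite EFinM.
  rewrite ge0_integralZl_EFin//; last first.
    by apply/measurable_EFinP; exact: measurable_indic.
  rewrite integral_indic// setIidl; last first.
    by move=> t /=; rewrite !in_itv/= andbT => /andP[/(lt_trans a0)].
  transitivity (c%:E * a%:E)%E; last by congr (_ * _)%E; exact/esym.
  by rewrite -EFinM /c; congr EFin; field; rewrite gt_eqF.
apply: ge0_le_integral_nonmeasurable => t; rewrite /= in_itv/= andbT => t0.
  by rewrite lee_fin mulr_ge0.
rewrite indicE; case: (boolP (t \in _)) => [|_]; last first.
  rewrite mulr0 mule_ge0// ?lee_fin ?powR_ge0//.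
  (* Over an empty set the supremum would be [-oo]; rescaling [z] to norm [t] gives a point of the
     set. *)
  have z0 : 0 < enorm z by apply: lt_le_trans az; rewrite mulr_gt0.
  apply: (@le_trans _ _ `|K ((t / enorm z) *: z)|%:E); first by rewrite lee_fin.
  apply: ereal_sup_ubound; exists ((t / enorm z) *: z) => //=.
  by rewrite enormZ gtr0_norm ?divr_gt0// divfK// gt_eqF.
rewrite inE/= in_itv/= mulr1 => /andP[at_ t2a].
have tz : t <= enorm z by apply: le_trans az; exact: ltW.
rewrite /c mulrC EFinM; apply: lee_pmul; rewrite ?lee_fin.
- by rewrite divr_ge0 ?powR_ge0// ltW// (lt_trans a0).
- exact: ltW.
(* The exponent [nu - 1] may have either sign, so the [nu]-th power and the inverse of [t] are
   bounded separately. *)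
- rewrite powRD ?(gt_eqF t0) ?implybT// powR_inv1 ?(ltW t0)//.
  apply: ler_pM; rewrite ?invr_ge0 ?powR_ge0 ?(ltW (lt_trans a0 a2a))//.
    by rewrite ge0_ler_powR ?nnegrE ?ltW.
  by rewrite lef_pV2 ?posrE ?(lt_trans a0)// ltW.
- apply: (@le_trans _ _ `|K z|%:E); first by rewrite lee_fin ltW.
  by apply: ereal_sup_ubound; exists z.
Qed.

End kernel.

(** * Mean and variance of the rescaled kernel *)

Lemma EFin_Rintegral (R : realType) (dT : measure_display)
    (T : measurableType dT) (P : probability T R) (f : T -> R) (M : R) :
  measurable_fun setT f -> (forall x, `|f x| <= M) ->
  (\int[P]_x (f x)%:E)%E = (\int[P]_x f x)%:E.
Proof.
move=> mf fM; rewrite /Rintegral fineK//.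
exact: integrable_fin_num (bounded_integrable P mf fM).
Qed.

Lemma normr_Rintegral_le (R : realType) (dT : measure_display)
    (T : measurableType dT) (P : probability T R) (f : T -> R) (M : R) :
  measurable_fun setT f -> (forall x, `|f x| <= M) -> `|\int[P]_x f x| <= M.
Proof.
move=> mf fM; have inf := bounded_integrable P mf fM.
have iM r : P.-integrable setT (EFin \o (fun=> r)).
  exact: finite_measure_integrable_cst.
rewrite ler_norml; apply/andP; split.
  rewrite -(Rintegral_probability_cst P (- M)); apply: le_Rintegral => // x _.
  by have := fM x; rewrite ler_norml => /andP[].
rewrite -[leRHS](Rintegral_probability_cst P); apply: le_Rintegral => // x _.
by have := fM x; rewrite ler_norml => /andP[].
Qed.

Lemma Rintegral_le_split (R : realType) (dT : measure_display)
    (T : measurableType dT) (P : probability T R) (f : T -> R) (B : set T)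
    (M q p : R) :
  measurable_fun setT f -> (forall x, `|f x| <= M) -> measurable B ->
  0 <= M -> 0 <= q -> (forall x, ~ B x -> f x <= q) -> (P B <= p%:E)%E ->
  \int[P]_x f x <= q + M * p.
Proof.
move=> mf fM mB M0 q0 fq Bp.
have mI : measurable_fun setT (\1_B : T -> R) by exact: measurable_indic.
have I1 x : `|\1_B x| <= 1 :> R.
  by rewrite indicE; case: (x \in B); rewrite ?normr1 ?normr0.
have iI := bounded_integrable P mI I1.
have iq : P.-integrable setT (EFin \o (fun=> q)).
  exact: finite_measure_integrable_cst.
have iMI : P.-integrable setT (EFin \o (fun x => M * \1_B x)).
  by have := integrableZl measurableT M iI.
apply: (@le_trans _ _ (\int[P]_x (q + M * \1_B x))).
  apply: le_Rintegral => //.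
  - exact: bounded_integrable mf fM.
  - by have := integrableD measurableT iq iMI.
  move=> x _; rewrite indicE; case: (boolP (x \in B)) => [_|].
    by rewrite mulr1 (le_trans (ler_norm _))// (le_trans (fM x))// lerDr.
  by rewrite mulr0 addr0 notin_setE => /fq.
rewrite (RintegralD measurableT iq iMI) (RintegralZl M measurableT iI).
rewrite Rintegral_probability_cst lerD2l ler_wpM2l// -lee_fin.
rewrite -(EFin_Rintegral P mI I1); apply: le_trans Bp.
by rewrite integral_indic// setIT.
Qed.

Lemma centered_second_moment_ge (R : realType) (dT : measure_display)
    (T : measurableType dT) (P : probability T R) (f : T -> R) (A : set T)
    (M k m : R) :
  measurable_fun setT f -> (forall x, `|f x| <= M) -> measurable A ->
  0 <= k -> m <= k / 2 -> (forall x, A x -> k <= f x) ->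
  (((k / 2) ^+ 2)%:E * P A <= (\int[P]_x ((f x - m) ^+ 2))%:E)%E.
Proof.
move=> mf fM mA k0 mk fA.
have mg : measurable_fun setT (fun x => (f x - m) ^+ 2).
  by apply: measurable_funX; apply: measurable_funB => //.
have gM x : `|(f x - m) ^+ 2| <= (M + `|m|) ^+ 2.
  have h : `|f x - m| <= M + `|m| by rewrite (le_trans (ler_normB _ _))// lerD2r.
  by rewrite normrX lerXn2r// nnegrE// (le_trans _ h).
rewrite -(EFin_Rintegral P mg gM) -integral_cst//.
apply: (@le_trans _ _ (\int[P]_(x in A) ((f x - m) ^+ 2)%:E)%E).
  apply: ge0_le_integral => //.
  - by move=> x _; rewrite lee_fin sqr_ge0.
  - by apply/measurable_EFinP; exact: measurable_funTS.
  move=> x Ax; rewrite lee_fin lerXn2r ?nnegrE ?divr_ge0//.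
    by rewrite subr_ge0 (le_trans mk)// (le_trans _ (fA x Ax))//; lra.
  by have := fA x Ax; lra.
apply: ge0_subset_integral => //; first exact/measurable_EFinP.
by move=> x _; rewrite lee_fin sqr_ge0.
Qed.

Lemma Rintegral_iid_sum (R : realType) (d : nat)
    (dO : measure_display) (Omega : measurableType dO)
    (Pr : probability Omega R) (X : nat -> {RV Pr >-> euclidean R d})
    (P : probability (euclidean R d) R) (f : euclidean R d -> R) (M : R) n :
  iid X P -> measurable_fun setT f -> (forall x, `|f x| <= M) ->
  \int[Pr]_w (\sum_(i < n) f (X i w)) = n%:R * \int[P]_x f x.
Proof.
move=> [_ lawX] mf fM.
have mfX i : measurable_fun setT (fun w => f (X i w)) by exact: measurableT_comp.
have fX i : \int[Pr]_w f (X i w) = \int[P]_x f x.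
  rewrite /Rintegral; congr fine.
  transitivity (\int[distribution Pr (X i)]_x (f x)%:E)%E.
    rewrite integral_distribution//; first exact/measurable_EFinP.
    by apply: bounded_integrable => [|w]; [exact: mfX|exact: fM].
  by apply: eq_measure_integral => A mA _; exact: lawX.
have iX i := bounded_integrable Pr (mfX i) (fun w => fM (X i w)).
have iS k : Pr.-integrable setT (EFin \o (fun w => \sum_(i < k) f (X i w))).
  apply: (@bounded_integrable _ _ _ _ _ (\sum_(i < k) M)).
    exact: measurable_sum.
  by move=> w; apply: le_trans (ler_norm_sum _ _ _) _; apply: ler_sum.
elim: n => [|n IHn].
  under eq_Rintegral do rewrite big_ord0.
  by rewrite Rintegral_probability_cst mul0r.
under eq_Rintegral do rewrite big_ord_recr.
by rewrite (RintegralD measurableT (iS n) (iX n)) IHn fX -natr1 mulrDl mul1r.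
Qed.

(** Boundedness of [K] makes the expectation finite. Keeping both factors [n%:R] makes the identity
    hold for [n = 0] as well. *)
Lemma mean_kdeE (R : realType) (d : nat)
    (dO : measure_display) (Omega : measurableType dO)
    (Pr : probability Omega R) (X : nat -> {RV Pr >-> euclidean R d})
    (P : probability (euclidean R d) R) (K : euclidean R d -> R)
    (M h : R) (n : nat) (x : euclidean R d) :
  iid X P -> measurable_fun setT K -> (forall z, `|K z| <= M) ->
  mean_kde K X n h x =
  ((n%:R * h ^+ d)^-1 * (n%:R * \int[P]_y K (h^-1 *: (x - y))))%:E.
Proof.
move=> iidX mK KM.
have mf : measurable_fun setT (fun y : euclidean R d => K (h^-1 *: (x - y))).
  exact: measurableT_comp (measurable_rescale h x).
have fM (y : euclidean R d) : `|K (h^-1 *: (x - y))| <= M by [].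
have mS : measurable_fun setT (fun w => \sum_(i < n) K (h^-1 *: (x - X i w))).
  by apply: measurable_sum => i; exact: (measurableT_comp mf).
have SM w : `|\sum_(i < n) K (h^-1 *: (x - X i w))| <= \sum_(i < n) M.
  by apply: le_trans (ler_norm_sum _ _ _) _; apply: ler_sum.
have iS := bounded_integrable Pr mS SM.
rewrite /mean_kde unlock.
have -> : (\int[Pr]_w (kde K X n h x w)%:E)%E = (\int[Pr]_w kde K X n h x w)%:E.
  rewrite /Rintegral fineK//; apply: integrable_fin_num => //.
  by have := integrableZl measurableT (n%:R * h ^+ d)^-1 iS.
rewrite /kde (RintegralZl _ measurableT iS).
by rewrite (Rintegral_iid_sum n iidX mf fM).
Qed.

(** The variance bound that feeds the anticoncentration. The point [x] and the constants precede [h]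
    and involve no sample, so the final constants inherit this. *)
Lemma kernel_second_moment (R : realType) (d : nat)
    (XX : set (euclidean R d)) (P : probability (euclidean R d) R) (nu : R)
    (K : euclidean R d -> R) (M : R) :
  (0 < volume_dimension XX P)%E -> 0 < nu ->
  (0 < ereal_sup [set limf_einf (fun r : R =>
     P (eball x r) / (r `^ nu)%:E) 0^'+ | x in XX])%E ->
  measurable_fun setT K -> 0 < M -> (forall z, `|K z| <= M) ->
  (\int[lebesgue_measure]_(t in `]0%R, +oo[)
     ((t `^ (nu - 1))%:E * sup_outside K t) < +oo)%E ->
  (0 < lim (inf_inside K t @[t --> 0^'+]))%E ->
  exists x, XX x /\ exists kappa h0 : R, [/\ 0 < kappa, 0 < h0 &
    forall h, 0 < h <= h0 ->
    kappa * h `^ nu <=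
      \int[P]_y ((K (h^-1 *: (x - y)) -
                   \int[P]_z K (h^-1 *: (x - z))) ^+ 2)].
Proof.
move=> vol0 nu0 lowP mK M0 KM tailK centerK.
have [x [Xx [c [r0 [c0 r00 Pr0]]]]] := ball_mass_lower lowP.
have [t0 [k [t00 k0 Kk]]] := kernel_positive_near0 centerK.
have k4 : 0 < k / 4 by rewrite divr_gt0.
have kM : 0 < k / (4 * M) by rewrite divr_gt0// mulr_gt0.
have [t1 t10 Kt1] := kernel_decay tailK nu0 k4.
have [r1 r10 Pr1] := ball_mass_upper vol0 Xx kM.
exists x; split => //.
(* [K >= k] on the ball of radius [h t0], whose mass is of order [h ^ nu], while
   the mean tends to [0] because [K] decays and [P] has no atom at [x]. *)
exists ((k / 2) ^+ 2 * (c * t0 `^ nu)), (Num.min (r0 / (2 * t0)) (r1 / (2 * t1))).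
split.
- by rewrite mulr_gt0 ?exprn_gt0 ?divr_gt0// mulr_gt0// powR_gt0.
- by rewrite lt_min; apply/andP; split; rewrite divr_gt0// mulr_gt0.
move=> h /andP[h0]; rewrite le_min => /andP[hr0 hr1].
pose f (y : euclidean R d) := K (h^-1 *: (x - y)).
have mf : measurable_fun setT f.
  exact: measurableT_comp (measurable_rescale h x).
have fM y : `|f y| <= M := KM _.
(* The factor 2 in the choice of [h0] turns [h <= h0] into the strict bound on radii. *)
have scale_lt (t r : R) : 0 < t -> 0 < r -> h <= r / (2 * t) -> 0 < h * t < r.
  move=> t_gt0 r_gt0; rewrite mulr_gt0//= ler_pdivlMr ?mulr_gt0// => hle.
  have : 0 < h * t by rewrite mulr_gt0.
  lra.
have normE y : enorm (h^-1 *: (x - y)) = enorm (y - x) / h.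
  by rewrite enormZ gtr0_norm ?invr_gt0// enormBC mulrC.
(* One [k / 4] bounds [f] outside the ball of radius [h * t1], the other is [M] times the mass of
   that ball. *)
have mean_le : \int[P]_y f y <= k / 2.
  have -> : k / 2 = k / 4 + M * (k / (4 * M)) by field; rewrite gt_eqF.
  apply: (Rintegral_le_split mf fM (measurable_eball x (h * t1))) => //.
  - exact: ltW.
  - by rewrite divr_ge0// ltW.
  - move=> y /negP; rewrite /eball/= -leNgt => hy.
    apply: le_trans (ler_norm _) (Kt1 _ _).
    by rewrite normE ler_pdivlMr// mulrC.
  - exact/Pr1/scale_lt.
have fk y : eball x (h * t0) y -> k <= f y.
  by rewrite /eball/= => hy; apply: Kk; rewrite normE ler_pdivrMr// mulrC ltW.
rewrite -lee_fin.
apply: le_trans; last exact: (centered_second_moment_ge P mf fM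
  (measurable_eball x (h * t0)) (ltW k0) mean_le fk).
rewrite -mulrA EFinM lee_wpmul2l ?lee_fin ?sqr_ge0//.
apply: le_trans (Pr0 _ (scale_lt _ _ t00 r00 hr0)).
by rewrite lee_fin powRM ?(ltW h0) ?(ltW t00)// -mulrA [t0 `^ _ * _]mulrC.
Qed.

(** * Lower bound for the uniform deviation *)

(** Quantifying [C] and [h0] before the sample and the bandwidths expresses what they may depend on.
    Smallness of [h n] is a separate premise because the growth condition does not force [h n] to
    tend to 0. *)
Theorem proposition16 (R : realType) (d : nat) (XX : set (euclidean R d))
    (delta : R) (delta01 : 0 < delta < 1)
    (P : probability (euclidean R d) R)
    (dvol : R) (dvolE : volume_dimension XX P = dvol%:E) (dvol_gt0 : 0 < dvol)
    (P_lower : (0 < ereal_sup [set limf_einf (fun r : R =>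
        P (eball x r) / (r `^ dvol)%:E) 0^'+ | x in XX])%E)
    (K : euclidean R d -> R) (mK : measurable_fun setT K)
    (K_bounded : (sup_norm K < +oo)%E)
    (K_tail : (\int[lebesgue_measure]_(t in `]0%R, +oo[)
        ((t `^ (dvol - 1))%:E * sup_outside K t) < +oo)%E)
    (K_center : (0 < lim (inf_inside K t @[t --> 0^'+]))%E) :
  exists C h0 : R, [/\ 0 < C, 0 < h0 &
    forall (dO : measure_display) (Omega : measurableType dO)
      (Pr : probability Omega R) (X : nat -> {RV Pr >-> euclidean R d})
      (h : nat -> R),
    iid X P ->
    (forall n, 0 < h n) ->
    n%:R * h n `^ dvol @[n --> \oo] --> +oo ->
    \forall n \near \oo, h n <= h0 ->
      with_probability_ge Pr (1 - delta) (fun w =>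
        ((C * Num.sqrt (1 / (n%:R * h n `^ (2 * d%:R - dvol))))%:E
         <= kde_deviation K X n (h n) XX w)%E)].
Proof.
have /andP[delta0 _] := delta01.
have [M M0 KM] := sup_norm_bound K_bounded.
have vol0 : (0 < volume_dimension XX P)%E by rewrite dvolE lte_fin.
have [x [Xx [kappa [h0 [kappa0 h00 var_ge]]]]] :=
  kernel_second_moment vol0 dvol_gt0 P_lower mK M0 KM K_tail K_center.
set q := delta ^+ 8 * kappa.
have q0 : 0 < q by rewrite mulr_gt0// exprn_gt0.
(* Anticoncentration has [4 * q * (n%:R * H)] available, with [H] the [dvol]-th power of [h n]; this
   [C] makes [512 * L ^+ 2] exactly half of it. *)
pose C := Num.sqrt (q / 256).
have C0 : 0 < C by rewrite sqrtr_gt0 divr_gt0 ?ltr0n.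
have C2 : C ^+ 2 = q / 256 by rewrite sqr_sqrtr ?divr_ge0 ?ler0n ?(ltW q0).
exists C, h0; split => // dO Omega Pr X h iidX h_gt0 nh_oo.
(* Once [n%:R * H] reaches [B], the other half covers the term in the bound [2 * M] on the centered
   summands. *)
pose B := 256 * (100 * (100 * (2 * M) ^+ 2)) / q.
have B0 : 0 < B.
  by apply: divr_gt0 q0; rewrite !mulr_gt0 ?ltr0n ?exprn_gt0 ?mulr_gt0 ?ltr0n.
near=> n => hn.
have nB : B <= n%:R * h n `^ dvol.
  near: n; have /cvgryPge := nh_oo; exact.
have n0 : 0 < n%:R :> R.
  rewrite lt_neqAle ler0n andbT; apply/eqP => n0.
  by move: nB; rewrite -n0 mul0r leNgt B0.
set H := h n `^ dvol in nB *.
have H0 : 0 < H by rewrite powR_gt0.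
pose f (y : euclidean R d) := K ((h n)^-1 *: (x - y)).
have mf : measurable_fun setT f.
  exact: measurableT_comp (measurable_rescale (h n) x).
have fM y : `|f y| <= M := KM _.
set m := \int[P]_y f y.
have mM : `|m| <= M := normr_Rintegral_le P mf fM.
pose Z y := f y - m.
have mZ : measurable_fun setT Z by exact: measurable_funB.
have ZM y : `|Z y| <= 2 * M.
  by rewrite (le_trans (ler_normB _ _))// mulr_natl mulr2n lerD.
have Z0 : \int[P]_y Z y = 0.
  rewrite RintegralB ?Rintegral_probability_cst ?subrr//.
    exact: bounded_integrable mf fM.
  exact: finite_measure_integrable_cst.
have var_n : kappa * H <= \int[P]_y (Z y ^+ 2).
  by apply: var_ge; rewrite h_gt0.
pose L := C * Num.sqrt (n%:R * H).
have L2 : L ^+ 2 = q / 256 * (n%:R * H).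
  by rewrite exprMn C2 sqr_sqrtr// mulr_ge0// ltW.
have small : (Pr [set w | (`|\sum_(i < n) Z (X i w)| < L)%R] <= delta%:E)%E.
  apply: (sum_anticoncentration iidX mZ ZM _ Z0 (ltW delta0)).
    by rewrite mulr_gt0.
  apply: (@le_trans _ _ (delta ^+ 8 * (n%:R * (4 * (kappa * H))))); last first.
    by rewrite !ler_wpM2l ?ler0n ?exprn_ge0// ltW.
  have -> : delta ^+ 8 * (n%:R * (4 * (kappa * H))) = 4 * (q * (n%:R * H)).
    by rewrite /q; ring.
  rewrite L2; move: nB; rewrite /B ler_pdivrMr// => nB.
  by set u := n%:R * H in nB *; set v := 100 * _ in nB *; lra.
have mS : measurable_fun setT (fun w => `|\sum_(i < n) Z (X i w)|).
  apply: (measurableT_comp (@normr_measurable _ setT)).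
  by apply: measurable_sum => i; exact: measurableT_comp.
set A := [set w | _] in small.
have mA : measurable A.
  rewrite (_ : A = setT `&` (fun w => `|\sum_(i < n) Z (X i w)|) @^-1` `]-oo, L[).
    exact: mS.
  by rewrite setTI; apply/seteqP; split => w /=; rewrite in_itv.
exists (~` A).
  split; first exact: measurableC.
  rewrite probability_setC// EFinB; apply: leeB => //.
move=> w /negP; rewrite /= -leNgt => Lw.
(* The supremum over [XX] is bounded below by its term at the single point [x]. *)
apply: le_trans (ereal_sup_ubound _); last by exists x.
rewrite (mean_kdeE _ _ _ iidX mK KM) -/m -EFinB lee_fin.
have nh0 : 0 < n%:R * h n ^+ d by rewrite mulr_gt0// exprn_gt0.
have -> : kde K X n (h n) x w - (n%:R * h n ^+ d)^-1 * (n%:R * m) =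
          (n%:R * h n ^+ d)^-1 * \sum_(i < n) Z (X i w).
  rewrite /kde -mulrBr; congr (_ * _).
  by rewrite sumrB sumr_const card_ord mulr_natl.
rewrite normrM gtr0_norm ?invr_gt0//.
apply: le_trans (ler_wpM2l _ Lw); last by rewrite invr_ge0 ltW.
(* The two sides agree: they are nonnegative and both have square [H / (n%:R * (h n ^+ d) ^+ 2)]. *)
rewrite /L mulrCA ler_pM2l// le_eqVlt; apply/orP; left; apply/eqP.
apply: (@pexpIrn _ 2) => //; rewrite ?nnegrE ?sqrtr_ge0//.
  by rewrite mulr_ge0 ?sqrtr_ge0// invr_ge0 ltW.
have hd : h n `^ (2 * d%:R - dvol) = (h n ^+ d) ^+ 2 / H.
  rewrite powRD ?(gt_eqF (h_gt0 n)) ?implybT// powRN -/H.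
  by rewrite -natrM powR_mulrn ?(ltW (h_gt0 n))// mulnC exprM.
have hd0 : 0 < h n ^+ d by rewrite exprn_gt0.
have rate_ge0 : 0 <= 1 / (n%:R * h n `^ (2 * d%:R - dvol)).
  by rewrite divr_ge0// mulr_ge0 ?ler0n ?powR_ge0.
have nH0 : 0 <= n%:R * H by rewrite mulr_ge0 ?ler0n ?(ltW H0).
rewrite [RHS]exprMn (sqr_sqrtr rate_ge0) (sqr_sqrtr nH0).
by rewrite hd; field; rewrite !gt_eqF.
Unshelve. all: by end_near. Qed.
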